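(* Let $n\ge4$ and let $w$ be a $cd$-monomial with $m$ occurrences of the variable $d$. Then: (1) if $\deg(w)=n-1$, then $[wc]\check\Phi^n_0\ge 2^m$; (2) if $n\ge5$, $1\le j\le n-1$ and $\deg(w)=n-2$, then $[wd]\check\Phi^n_j\ge 2^m$.
   Context: $cd$-monomials are words in non-commuting variables $c,d$ with $\deg c=1$, $\deg d=2$; $[w]p$ denotes the coefficient of the monomial $w$ in the polynomial $p$. The polynomials $\check\Phi^n_i$: let $\Lambda^n$ be the boundary complex of an $n$-simplex with facets $\sigma_0,\dots,\sigma_n$; for $0\le i\le n-1$ let $\Gamma^n_i$ be the simplicial complex generated by $\sigma_0,\dots,\sigma_i$, and $\Lambda^n_i$ the regular CW complex obtained from $\Gamma^n_i$ by attaching one new $(n-1)$-cell $\tau$ with $\partial\tau=\partial\Gamma^n_i$. For such a CW sphere $\Lambda$, $\Phi_\Lambda$ is the $cd$-index of its face poset $Q$ with $\hat0,\hat1$ adjoined (Eulerian of rank $n+1$): the unique polynomial with $\Phi_Q(a+b,ab+ba)=\sum_{S\subseteq[n]}h_S(Q)u_S$, where $h_S(Q)=\sum_{T\subseteq S}(-1)^{|S\setminus T|}f_T(Q)$, $f_T(Q)$ is the number of chains $\hat0<x_1<\dots<x_k<\hat1$ whose rank set is $T$, and $u_S=u_1\cdots u_n$ with $u_i=b$ if $i\in S$, $a$ otherwise. Set $\check\Phi^n_0=\Phi_{\Lambda^n_0}$, $\check\Phi^n_i=\Phi_{\Lambda^n_i}-\Phi_{\Lambda^n_{i-1}}$ for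 $1\le i\le n-1$, $\check\Phi^n_n=0$. *)

(* Defs.v *)
From HB Require Import structures.
From mathcomp Require Import all_boot all_order all_algebra.
Set Implicit Arguments. Unset Strict Implicit. Unset Printing Implicit Defensive.
Import GRing.Theory Num.Theory.
Local Open Scope ring_scope.

(* ab-monomials: seq bool, with false = a, true = b.                          *)
Inductive cdletter := Lc | Ld.

Definition cdlet_deg (x : cdletter) : nat := if x is Ld then 2%N else 1%N.
Definition cddeg (w : seq cdletter) : nat := sumn (map cdlet_deg w).
Definition is_d (x : cdletter) : bool := if x is Ld then true else false.
Definition nd (w : seq cdletter) : nat := count is_d w.

Fixpoint cdwords (n : nat) : seq (seq cdletter) :=
  match n with
  | 0 => [:: [::]]
  | 1 => [:: [:: Lc]]
  | (k.+1 as m).+1 => map (cons Lc) (cdwords m) ++ map (cons Ld) (cdwords k)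
  end.

(* expansion of a cd-monomial under c := a+b, d := ab+ba, as the list (with
   multiplicity) of the ab-monomials occurring in it *)
Fixpoint expand (w : seq cdletter) : seq (seq bool) :=
  match w with
  | [::] => [:: [::]]
  | Lc :: w' => [seq x :: v | x <- [:: false; true], v <- expand w']
  | Ld :: w' => [seq x ++ v | x <- [:: [:: false; true]; [:: true; false]],
                              v <- expand w']
  end.

(* Phi (a cd-polynomial, given by its coefficient function) is the cd-index
   of the ab-index Psi of a poset of rank n+1, i.e.
   Phi(a+b, ab+ba) = Psi, where Psi is homogeneous of degree n. *)
Definition is_cd_index (n : nat) (Phi : seq cdletter -> int)
    (Psi : seq bool -> int) : Prop :=
  (forall w, cddeg w != n -> Phi w = 0) /\
  (forall u : seq bool, size u = n ->
     \sum_(w <- cdwords n) Phi w * (count_mem u (expand w))%:Z = Psi u).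

(* The proper part of the poset is given by a finite type E, a predicate P
   selecting the elements, a strict order lt and a rank function rk.
   Chains x_1 < ... < x_k of proper elements are the totally ordered subsets;
   T : {set 'I_n} encodes the rank set {i.+1 | i in T} subset of [n]. *)
Definition flag_f (E : finType) (P : pred E) (lt : rel E) (rk : E -> nat)
    (n : nat) (T : {set 'I_n}) : nat :=
  #|[set C : {set E} |
      [&& [forall x in C, P x && (0 < rk x <= n)%N],
          [forall x in C, forall y in C, [|| x == y, lt x y | lt y x]] &
          [set i : 'I_n | [exists x in C, rk x == i.+1]] == T]]|.

Definition flag_h (E : finType) (P : pred E) (lt : rel E) (rk : E -> nat)
    (n : nat) (S : {set 'I_n}) : int :=
  \sum_(T : {set 'I_n} | T \subset S)
     (-1) ^+ #|S :\: T| * (flag_f P lt rk T)%:Z.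

(* ab-index: coefficient of the ab-word u (of length n) is h_{S(u)},
   S(u) = positions (1-based) of the letters b in u. *)
Definition ab_index (E : finType) (P : pred E) (lt : rel E) (rk : E -> nat)
    (n : nat) (u : seq bool) : int :=
  flag_h P lt rk [set i : 'I_n | nth false u i].

(* Vertices 0..n of the n-simplex; facet sigma_k = {0..n} \ {k}.
   Cells of Lambda^n_i: Some X for a nonempty simplex X of Gamma^n_i (X misses
   some k <= i), and None for the new (n-1)-cell tau, whose boundary is the
   boundary of Gamma^n_i, i.e. the faces contained in a ridge
   {0..n} \ {a,b} with a <= i < b. *)
Definition cell (n : nat) := option {set 'I_n.+1}.

Definition is_cell (n i : nat) (x : cell n) : bool :=
  match x with
  | Some X => (X != set0) && [exists k : 'I_n.+1, (k <= i)%N && (k \notin X)]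
  | None => true
  end.

Definition cell_le (n i : nat) (x y : cell n) : bool :=
  match x, y with
  | Some X, Some S2 => X \subset S2
  | Some X, None => [exists a : 'I_n.+1, exists b : 'I_n.+1,
                       [&& (a <= i)%N, (i < b)%N, a \notin X & b \notin X]]
  | None, Some _ => false
  | None, None => true
  end.

Definition cell_lt (n i : nat) (x y : cell n) : bool :=
  (x != y) && cell_le i x y.

Definition cell_rank (n : nat) (x : cell n) : nat :=
  match x with Some X => #|X| | None => n end.

(* ab-index of the face poset of Lambda^n_i (with 0^ and 1^ adjoined) *)
Definition Lambda_ab (n i : nat) : seq bool -> int :=
  ab_index (@is_cell n i) (@cell_lt n i) (@cell_rank n) n.

(* Main.v *)
Require Import Defs.
From mathcomp Require Import all_boot all_order all_algebra.
From mathcomp Require Import zify ring.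
Import Order.TTheory GRing.Theory Num.Theory.
Local Open Scope ring_scope.

(** Let D^n_i be the flag-f enumerator of Lambda^n_i minus that of
    Lambda^n_{i-1}.  Chains are counted by their top simplex, the chains below a
    simplex being those of a Boolean lattice, so D^n_i has a closed form in
    binomial coefficients, and Pascal's rule gives D^{n+1}_{i+1} = G(D^n_i) for a
    derivation G.  On the ab-index G is a -> ba, b -> ab (Ehrenborg and Readdy),
    hence c -> d, d -> cd on cd-polynomials; on flag-f enumerators it becomes
    a -> ba - ab, b -> ab + bb.  The same derivation gives
    Phi(B_{n+1}) = Phi(B_n) c + G(Phi(B_n)), while checkPhi^n_0 = Phi(B_n) c.  By
    uniqueness of the cd-index, checkPhi^n_i = G^i(Phi(B_{n-i}) c), and both lower
    bounds follow by induction, since G has nonnegative coefficients.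

    Noncommutative polynomials are coefficient functions on reversed words: the
    head of a word is its last letter, that is, the highest rank. *)

(** * Coefficient functions: the substitution, the derivation in its three forms, the expansion of
    cd-words *)

(** From a flag-f to a flag-h enumerator: the substitution a -> a - b. *)
Fixpoint h_of_f (P : seq bool -> int) (r : seq bool) : int :=
  match r with
  | [::] => P [::]
  | false :: r' => h_of_f (fun v => P (false :: v)) r'
  | true :: r' => h_of_f (fun v => P (true :: v)) r' - h_of_f (fun v => P (false :: v)) r'
  end.

(** The derivation a -> ba, b -> ab. *)
Fixpoint derh (P : seq bool -> int) (r : seq bool) : int :=
  match r with
  | [::] => 0
  | x :: r' => derh (fun v => P (x :: v)) r' +
      (if r' is y :: r'' then if y != x then P (x :: r'') else 0 else 0)
  end.

(** The derivation a -> ba - ab, b -> ab + bb, conjugate of [derh] under [h_of_f]. *)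
Fixpoint derf (P : seq bool -> int) (r : seq bool) : int :=
  match r with
  | [::] => 0
  | x :: r' => derf (fun v => P (x :: v)) r' +
      (if r' is y :: r'' then
         match x, y with
         | false, false => 0
         | true, false => P (true :: r'') - P (false :: r'')
         | _, true => P (x :: r'')
         end
       else 0)
  end.

(** The derivation c -> d, d -> cd. *)
Fixpoint dercd (Phi : seq cdletter -> int) (w : seq cdletter) : int :=
  match w with
  | [::] => 0
  | Lc :: w' => dercd (fun v => Phi (Lc :: v)) w'
  | Ld :: w' => Phi (Lc :: w') + dercd (fun v => Phi (Ld :: v)) w' +
      (if w' is Lc :: w'' then Phi (Ld :: w'') else 0)
  end.

(** The coefficients of Phi(a+b, ab+ba). *)
Fixpoint ev (Phi : seq cdletter -> int) (u : seq bool) : int :=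
  match u with
  | [::] => Phi [::]
  | x :: u' => ev (fun v => Phi (Lc :: v)) u' +
      (if u' is y :: u'' then
         if y != x then ev (fun v => Phi (Ld :: v)) u'' else 0
       else 0)
  end.

(** * Linearity, and the conjugation of [derf] into [derh] *)

Lemma eq_h_of_f (P Q : seq bool -> int) (r : seq bool) :
  (forall v, size v = size r -> P v = Q v) -> h_of_f P r = h_of_f Q r.
Proof.
elim: r P Q => [|[] r IH] P Q PQ /=; first exact: PQ.
  by congr (_ - _); apply: IH => v sv; apply: PQ; rewrite /= sv.
by apply: IH => v sv; apply: PQ; rewrite /= sv.
Qed.

Lemma h_of_fD (P Q : seq bool -> int) (r : seq bool) :
  h_of_f (fun v => P v + Q v) r = h_of_f P r + h_of_f Q r.
Proof. by elim: r P Q => [|[] r IH] P Q //=; rewrite !IH; ring. Qed.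

Lemma h_of_fB (P Q : seq bool -> int) (r : seq bool) :
  h_of_f (fun v => P v - Q v) r = h_of_f P r - h_of_f Q r.
Proof. by elim: r P Q => [|[] r IH] P Q //=; rewrite !IH; ring. Qed.

Lemma h_of_f0 (r : seq bool) : h_of_f (fun=> 0) r = 0.
Proof. by elim: r => [|[] r IH] //=; rewrite IH ?subr0. Qed.

Lemma eq_derh (P Q : seq bool -> int) (r : seq bool) :
  (forall v, (size v).+1 = size r -> P v = Q v) -> derh P r = derh Q r.
Proof.
elim: r P Q => [|x r IH] P Q PQ //=; congr (_ + _).
  by apply: IH => v sv; apply: PQ; rewrite /= sv.
by case: r {IH} PQ => [|y r] PQ //; case: ifP => // _; apply: PQ.
Qed.

Lemma derhB (P Q : seq bool -> int) (r : seq bool) :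
  derh (fun v => P v - Q v) r = derh P r - derh Q r.
Proof.
elim: r P Q => [|x r IH] P Q //=.
by rewrite IH; case: r {IH} => [|y r]; [|case: ifP => _]; ring.
Qed.

Lemma derhD (P Q : seq bool -> int) (r : seq bool) :
  derh (fun v => P v + Q v) r = derh P r + derh Q r.
Proof.
elim: r P Q => [|x r IH] P Q //=.
by rewrite IH; case: r {IH} => [|y r]; [|case: ifP => _]; ring.
Qed.

Lemma derh0 (r : seq bool) : derh (fun=> 0) r = 0.
Proof. by elim: r => [|x [|y r] IH] //=; rewrite /= in IH; rewrite IH if_same. Qed.

Lemma eq_derf (P Q : seq bool -> int) (r : seq bool) :
  (forall v, (size v).+1 = size r -> P v = Q v) -> derf P r = derf Q r.
Proof.
elim: r P Q => [|x r IH] P Q PQ //=; congr (_ + _).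
  by apply: IH => v sv; apply: PQ; rewrite /= sv.
by case: r {IH} PQ => [|[] r] PQ //; case: x PQ => PQ; rewrite ?PQ.
Qed.

Lemma derfZ (c : int) (P : seq bool -> int) (r : seq bool) :
  derf (fun v => c * P v) r = c * derf P r.
Proof.
elim: r P => [|x r IH] P //=; first by rewrite mulr0.
by rewrite IH; case: r {IH} => [|[] r]; case: x; ring.
Qed.

(** It is enough to compare on letters. Under a -> a - b, the word ba - ab goes to itself, the image
    of a - b under a -> ba, b -> ab; and ab + bb goes to ab, the image of b. *)
Lemma h_of_f_derf (P : seq bool -> int) (r : seq bool) :
  h_of_f (derf P) r = derh (h_of_f P) r.
Proof.
elim: r P => [|[] r IH] P //=; rewrite !h_of_fD !IH.
  rewrite derhB; case: r {IH} => [|[] r] /=; rewrite ?h_of_f0 ?h_of_fB; ring.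
by congr (_ + _); case: r {IH} => [|[] r] /=; rewrite ?h_of_f0 ?subr0.
Qed.

(** * Expansion of cd-polynomials: derivation, reversal, uniqueness *)

Lemma ev0 (u : seq bool) : ev (fun=> 0) u = 0.
Proof.
elim: {u}(size u).+1 {-2}u (leqnn (size u).+1) => // n IH [|x u] //= su.
rewrite IH; last by lia.
by case: u su => [|y u] //= su; case: ifP => // _; rewrite IH //; lia.
Qed.

Lemma evD (P Q : seq cdletter -> int) (u : seq bool) :
  ev (fun v => P v + Q v) u = ev P u + ev Q u.
Proof.
elim: {u}(size u).+1 {-2}u (leqnn (size u).+1) P Q => // n IH [|x u] //= su P Q.
rewrite IH; last by lia.
case: u su => [|y u] //= su; first by ring.
by case: ifP => // _; rewrite ?IH /=; try lia; ring.
Qed.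

Lemma evB (P Q : seq cdletter -> int) (u : seq bool) :
  ev (fun v => P v - Q v) u = ev P u - ev Q u.
Proof.
elim: {u}(size u).+1 {-2}u (leqnn (size u).+1) P Q => // n IH [|x u] //= su P Q.
rewrite IH; last by lia.
case: u su => [|y u] //= su; first by ring.
by case: ifP => // _; rewrite ?IH /=; try lia; ring.
Qed.

(** Multiplication by c on the right, words being reversed. *)
Definition mulc (Phi : seq cdletter -> int) (w : seq cdletter) : int :=
  if w is Lc :: w' then Phi w' else 0.

Lemma ev_mulc (Phi : seq cdletter -> int) (x : bool) (u : seq bool) :
  ev (mulc Phi) (x :: u) = ev Phi u.
Proof.
by rewrite /=; case: u => [|y u]; rewrite ?addr0 //= ev0 if_same addr0.
Qed.

Lemma ev_mulcE (Phi : seq cdletter -> int) (u : seq bool) :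
  ev (fun v => if v is Lc :: v' then Phi v' else 0) u =
  if u is x :: u' then ev Phi u' else 0.
Proof. by case: u => // x u; apply: ev_mulc. Qed.

Lemma derh_mul (Q : seq bool -> int) (x y : bool) (u : seq bool) :
  derh (fun v => if v is z :: v' then if z != x then Q v' else 0 else 0) (y :: u) =
  if y != x then derh Q u + (if u is z :: u' then if z == x then Q u' else 0 else 0)
  else 0.
Proof.
rewrite /=; case: (y =P x) => [<-|/eqP yx] /=.
  by rewrite derh0; case: u => // z u; rewrite if_same.
by case: u => // z u; congr (_ + _); move: x y z yx => [] [] [].
Qed.

(** The derivation a -> ba, b -> ab sends a + b to ba + ab = d, and ab + ba to bab + aab + aba + bba
    = (a + b)(ab + ba) = cd. *)
Lemma ev_dercd (Phi : seq cdletter -> int) (u : seq bool) :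
  ev (dercd Phi) u = derh (ev Phi) u.
Proof.
elim: {u}(size u).+1 {-2}u (leqnn (size u).+1) Phi => // n IH [|x u] //= su Phi.
rewrite IH; last by lia.
case: u su => [|y u] su; first by rewrite /=; ring.
rewrite derhD derh_mul !evD ev_mulcE IH; last by move: su => /=; lia.
rewrite -[RHS]addrA; congr (_ + _); case: (y != x); last by ring.
by case: u {su} => [|z u] /=; [|case: eqP => _ /=]; ring.
Qed.

Lemma eq_ev (P Q : seq cdletter -> int) (u : seq bool) :
  P =1 Q -> ev P u = ev Q u.
Proof.
elim: {u}(size u).+1 {-2}u (leqnn (size u).+1) P Q => // n IH [|x u] //= su P Q PQ.
congr (_ + _); first by apply: IH => // v; apply: PQ.
case: u su => [|y u] //= su; case: ifP => // _.
by apply: IH => [|v]; [lia | apply: PQ].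
Qed.

(** Sorting cd-words by their first letter gives the recursion of [ev]: c expands to either letter,
    d to two distinct letters. *)
Lemma sum_cdwords_ev (Phi : seq cdletter -> int) (u : seq bool) :
  \sum_(w <- cdwords (size u)) Phi w * (count_mem u (expand w))%:Z = ev Phi u.
Proof.
have cnt_cons x z v (s : seq (seq bool)) :
    count_mem (x :: v) [seq z :: t | t <- s] = ((z == x) * count_mem v s)%N.
  elim: s => [|t s IH] /=; first by rewrite muln0.
  by rewrite IH eqseq_cons mulnDr; case: (z == x); rewrite ?mul0n ?mul1n.
have cntc x v w : count_mem (x :: v) (expand (Lc :: w)) = count_mem v (expand w).
  by rewrite /= cats0 count_cat !cnt_cons; case: x; rewrite ?mul0n ?mul1n ?addn0.
have cntd x y v w : count_mem [:: x, y & v] (expand (Ld :: w)) =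
    if y != x then count_mem v (expand w) else 0%N.
  rewrite /= cats0 count_cat.
  have map2 (a b : bool) (s : seq (seq bool)) :
    [seq [:: a; b] ++ t | t <- s] = [seq a :: t | t <- [seq b :: t | t <- s]].
    by rewrite -map_comp.
  rewrite !map2 !cnt_cons.
  by case: x; case: y; rewrite ?mul0n ?mul1n ?muln0 ?muln1 ?addn0.
elim: {u}(size u).+1 {-2}u (leqnn (size u).+1) Phi => // n IH [|x [|y u]] su Phi.
- by rewrite /= big_seq1 /= mulr1.
- by rewrite /= big_seq1 cntc /= mulr1 addr0.
rewrite [cdwords _]/= big_cat !big_map.
rewrite [ev _ _]/=; congr (_ + _).
  under eq_bigr do rewrite cntc.
  by apply: (IH (y :: u)).
under eq_bigr do rewrite cntd.
case: ifP => _; last by rewrite big1 // => w _; rewrite mulr0.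
by apply: IH; move: su => /=; lia.
Qed.

(** The recursion of [ev] carried out at the other end of the word, as needed for [ev_rev]. *)
Lemma ev_rcons (Phi : seq cdletter -> int) (u : seq bool) (y x : bool) :
  ev Phi (rcons (rcons u y) x) =
  ev (fun w => Phi (rcons w Lc)) (rcons u y) +
  (if y != x then ev (fun w => Phi (rcons w Ld)) u else 0).
Proof.
elim: {u}(size u).+1 {-2}u (leqnn (size u).+1) Phi => // n IH [|z [|t u]] su Phi.
- by case: (x) (y) => [] [] /=; ring.
- by case: (x) (y) (z) => [] [] [] /=; ring.
have IH1 := IH (t :: u) _ (fun w => Phi (Lc :: w)).
have IH2 := IH u _ (fun w => Phi (Ld :: w)).
rewrite !rcons_cons /= in IH1 IH2 *.
rewrite IH1 ?IH2; try (move: su => /=; lia).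
by case: (y != x); case: (t != z); ring.
Qed.

(** Reversing words fixes a + b and ab + ba. *)
Lemma ev_rev (Phi : seq cdletter -> int) (u : seq bool) :
  ev (fun w => Phi (rev w)) (rev u) = ev Phi u.
Proof.
elim: {u}(size u).+1 {-2}u (leqnn (size u).+1) Phi => // n IH [|x [|y u]] su Phi //.
rewrite !rev_cons ev_rcons; transitivity (ev (fun v => Phi (Lc :: v)) (y :: u) +
  (if y != x then ev (fun v => Phi (Ld :: v)) u else 0)); last by [].
rewrite -(IH (y :: u)) // -(IH u) ?rev_cons; last by move: su => /=; lia.
congr (_ + _); first by apply: eq_ev => w; rewrite rev_rcons.
by case: ifP => // _; apply: eq_ev => w; rewrite rev_rcons.
Qed.

(** Uniqueness of the cd-index. No d expands to two equal letters, so words starting with a repeated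
    letter isolate the part of [Phi] starting with c. Once that part vanishes, words starting with
    two distinct letters isolate the part starting with d. *)
Lemma ev_eq0 (Phi : seq cdletter -> int) (w : seq cdletter) :
  (forall u, size u = cddeg w -> ev Phi u = 0) -> Phi w = 0.
Proof.
elim: w Phi => [|l w IH] Phi Phi0; first exact: (Phi0 [::]).
have Phic0 (u : seq bool) : (size u).+1 = cddeg (l :: w) ->
    ev (fun v => Phi (Lc :: v)) u = 0.
  case: u => [|y u] su; first by have := Phi0 [:: true] su; rewrite /= addr0.
  by have := Phi0 [:: y, y & u] su; rewrite /= eqxx addr0.
apply: (IH (fun v => Phi (l :: v))) => u su.
case: l Phi0 Phic0 => Phi0 Phic0.
  by apply: Phic0; rewrite su.
have su2 : (size (false :: u)).+1 = cddeg (Ld :: w) by rewrite /= su.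
have := Phi0 [:: true, false & u] su2.
rewrite -[ev _ [:: true, false & u]]/(ev (fun v => Phi (Lc :: v)) (false :: u) + _).
by rewrite Phic0 // add0r.
Qed.

(** * Chains counted by their top simplex, in closed binomial form *)

Definition shift (q : nat -> int) (t : nat) : int := if t is t'.+1 then q t' else 0.

(** Number of chains of simplices with rank word [r] when [q t] simplices of
    size [t] may be the top of the chain; [q 0] counts the empty chain. *)
Fixpoint topsum (q : nat -> int) (r : seq bool) : int :=
  match r with
  | [::] => q 0
  | false :: r' => topsum q r'
  | true :: r' => q (size r').+1 * topsum (fun t => ('C((size r').+1, t))%:Z) r'
  end.

Lemma eq_topsum (p q : nat -> int) (r : seq bool) :
  (forall t, (t <= size r)%N -> p t = q t) -> topsum p r = topsum q r.
Proof.
elim: r => [|[] r IH] pq /=; first exact: pq.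
  by rewrite pq.
by apply: IH => t tr; apply: pq; rewrite /= leqW.
Qed.

Lemma topsumD (p q : nat -> int) (r : seq bool) :
  topsum (fun t => p t + q t) r = topsum p r + topsum q r.
Proof. by elim: r => [|[] r IH] //=; rewrite mulrDl. Qed.

Lemma topsumB (p q : nat -> int) (r : seq bool) :
  topsum (fun t => p t - q t) r = topsum p r - topsum q r.
Proof. by elim: r => [|[] r IH] //=; rewrite mulrBl. Qed.

Lemma topsum_bin (m : nat) (r : seq bool) :
  topsum (fun t => ('C(m.+1, t))%:Z) r =
  topsum (shift (fun t => ('C(m, t))%:Z)) r + topsum (fun t => ('C(m, t))%:Z) r.
Proof.
rewrite -topsumD; apply: eq_topsum => -[|t] _ /=; first by rewrite !bin0.
by rewrite binS PoszD addrC.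
Qed.

Lemma derf_topsum (q : nat -> int) (r : seq bool) :
  derf (topsum q) r =
  topsum (shift q) r - (if r is true :: r' then topsum q r' else 0).
Proof.
elim: r q => [|x r IH] q; first by rewrite /= subr0.
case: x; last first.
  rewrite /= IH subr0 -addrA; case: r {IH} => [|[] r] /=; ring.
rewrite [LHS]/=.
(* [derf] evaluates its argument only on words one letter shorter than [r], so the factor
   [q (size v).+1] is the constant [q (size r)] and comes out of the derivation. *)
transitivity (derf (fun v => q (size r) * topsum (fun t => ('C(size r, t))%:Z) v) r +
  (if r is y :: r'' then
     if y then topsum q (true :: r'') else topsum q (true :: r'') - topsum q (false :: r'')
   else 0)).
  congr (_ + _).
  by apply: eq_derf => v sv /=; rewrite sv.
rewrite derfZ IH /= {IH}.
case: r => [|[] r] /=.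
- by rewrite bin0; ring.
- rewrite !binSn (intS (size r).+1); ring.
- by rewrite (topsum_bin (size r).+1); ring.
Qed.

(** The flag-f version of checkPhi^n_i, see [Lambda_f0] and [Lambda_f_diff]. *)
Definition check_f (n i : nat) (r : seq bool) : int :=
  match r with
  | [::] => 0
  | false :: r' => topsum (fun t => ('C(n - i, n - t))%:Z) r'
  | true :: r' =>
      topsum (fun t => ('C(n, t))%:Z + ('C(n - i, n - t))%:Z - ('C(i, n - t))%:Z) r'
  end.

(** [derf_topsum] turns the right side into enumerators of the same shape. When the second letter is
    b, its correction cancels the extra term of [derf]; the remaining coefficients agree by Pascal's
    rule. *)
Lemma check_f_derf (n i : nat) (r : seq bool) :
  (i < n)%N -> size r = n.+1 -> check_f n.+1 i.+1 r = derf (check_f n i) r.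
Proof.
move=> lt_in; case: r => // x r [sr].
case: x; last first.
  transitivity (derf (topsum (fun t => ('C(n - i, n - t))%:Z)) r +
    (if r is true :: r' then topsum (fun t => ('C(n - i, n - t))%:Z) r' else 0)); last first.
    by congr (_ + _); case: (r) => [|[] ?].
  rewrite derf_topsum subrK [LHS]/=; apply: eq_topsum => -[|t] _ /=.
    by rewrite subSS bin_small //; lia.
  by rewrite !subSS.
pose a t : int := ('C(n - i, n - t))%:Z.
pose b t : int := ('C(n, t))%:Z + ('C(n - i, n - t))%:Z - ('C(i, n - t))%:Z.
transitivity (derf (topsum b) r + (if r is y :: r' then
    if y then topsum b r' else topsum b r' - topsum a r' else 0)); last first.
  by congr (_ + _); case: (r) => [|[] ?].
rewrite derf_topsum [LHS]/=.
case: r sr => [|y r] sr; first by move: lt_in; rewrite -sr.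
rewrite -addrA; case: y sr => sr.
  have {}sr : n = (size r).+1 by rewrite -sr.
  rewrite addNr addr0 /=; congr (_ * _).
  rewrite /b sr !subSS subSnn !bin1 !binSn.
  lia.
rewrite oppr0 add0r -topsumB; rewrite /= -topsumD; apply: eq_topsum => t tr.
have {sr}tn : (t < n)%N by move: sr tr => /=; lia.
(* At t = 0 the shifted term is 0, and i < n makes ['C(n - i, n.+1)], ['C(i.+1, n.+1)] and
   ['C(i, n)] vanish. *)
rewrite /a /b; case: t tn {tr} => [|t] tn /=.
  rewrite !bin0 !subn0 subSS (@bin_small (n - i) n.+1) ?(@bin_small i.+1 n.+1) //; last by lia.
  by rewrite (@bin_small i n) //; ring.
rewrite !subSS binS.
have -> : (n - t = (n - t.+1).+1)%N by lia.
rewrite (binS i) !PoszD; ring.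
Qed.

(** * cd-indices of Boolean lattices and of the check polynomials *)

(** The cd-index of the Boolean lattice B_{k+1}. *)
Fixpoint simplex_cd (k : nat) (w : seq cdletter) : int :=
  match k with
  | 0 => if w is [::] then 1 else 0
  | k'.+1 => mulc (simplex_cd k') w + dercd (simplex_cd k') w
  end.

(** checkPhi^{k+i+1}_i. *)
Fixpoint check_cd (i k : nat) : seq cdletter -> int :=
  match i with
  | 0 => mulc (simplex_cd k)
  | i'.+1 => dercd (check_cd i' k)
  end.

Lemma ev_simplex_cd (k : nat) (r : seq bool) : size r = k ->
  ev (simplex_cd k) r = h_of_f (topsum (fun t => ('C(k.+1, t))%:Z)) r.
Proof.
elim: k r => [[]//|k IH] [//|x r] [sr].
rewrite [ev _ _](evD (mulc (simplex_cd k)) (dercd (simplex_cd k))) ev_mulc ev_dercd IH //.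
rewrite (eq_derh _ (h_of_f (topsum (fun t => ('C(k.+1, t))%:Z)))); last first.
  by move=> v [sv]; rewrite IH // sv.
rewrite -h_of_f_derf.
set U := topsum (fun t => ('C(k.+1, t))%:Z).
(* Pascal's rule and [derf_topsum] split the enumerator of the next Boolean lattice into the
   derivation and multiplication by a + 2b, which a -> a - b takes to a + b = c. *)
rewrite (eq_h_of_f (topsum (fun t => ('C(k.+2, t))%:Z)) (fun v => derf U v +
   (if v is y :: v' then (if y then 2 else 1) * U v' else 0))); last first.
  move=> [//|y v] [sv]; rewrite topsum_bin derf_topsum.
  case: y => /=; rewrite ?sv ?sr ?binn ?mul1r; last by rewrite /U; ring.
  by rewrite /U; ring.
rewrite h_of_fD addrC; congr (_ + _); case: x => /=.
  rewrite -h_of_fB; apply: eq_h_of_f => v _; ring.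
by apply: eq_h_of_f => v _; rewrite mul1r.
Qed.

Lemma ev_check_cd (i k : nat) (r : seq bool) : size r = (k + i).+1 ->
  ev (check_cd i k) r = h_of_f (check_f (k + i).+1 i) r.
Proof.
elim: i r => [|i IH] r sr.
  case: r sr => [//|x r]; rewrite addn0 => -[sr].
  (* After a -> a - b either head letter leaves the Boolean enumerator, because ['C(0, k.+1 - t)] is
     0 for t <= k. *)
  rewrite ev_mulc ev_simplex_cd // /=; case: x; rewrite -?h_of_fB;
    apply: eq_h_of_f => v sv; rewrite -?topsumB; apply: eq_topsum => t tv;
    rewrite subn0 bin_sub //; try (rewrite sv in tv; lia).
  by rewrite bin0n; case: (k.+1 - t)%N (subn_gt0 t k.+1) => [|?] //=; [lia | move=> _; ring].
rewrite [ev _ _]ev_dercd addnS in sr *.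
rewrite (eq_derh _ (h_of_f (check_f (k + i).+1 i))); last first.
  by move=> v; rewrite sr => -[]; apply: IH.
rewrite -h_of_f_derf; apply: eq_h_of_f => v sv; rewrite check_f_derf ?sv //; lia.
Qed.

(** * Nonnegativity and lower bounds for the coefficients *)

Lemma dercd_ge0 (Phi : seq cdletter -> int) (w : seq cdletter) :
  (forall v, 0 <= Phi v) -> 0 <= dercd Phi w.
Proof.
elim: w Phi => [|[] w IH] Phi Phi0 //=; first exact: IH.
rewrite !addr_ge0 ?IH //.
by case: w {IH} => [|[] w].
Qed.

Lemma simplex_cd_ge0 (k : nat) (w : seq cdletter) : 0 <= simplex_cd k w.
Proof.
elim: k w => [|k IH] w /=; first by case: w.
by rewrite addr_ge0 ?dercd_ge0 //; case: w => [|[] w] /=.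
Qed.

Lemma check_cd_ge0 (i k : nat) (w : seq cdletter) : 0 <= check_cd i k w.
Proof.
elim: i w => [|i IH] w /=; last exact: dercd_ge0.
by case: w => [|[] w] //=; apply: simplex_cd_ge0.
Qed.

Lemma cddeg3 (w : seq cdletter) : cddeg w = 3 ->
  [\/ w = [:: Lc; Lc; Lc], w = [:: Lc; Ld] | w = [:: Ld; Lc]].
Proof.
case: w => [//|[] [|[] [|[] [|x w]]]] //=; rewrite /cddeg /=; try lia; try by constructor.
all: by case: x => /=; lia.
Qed.

(** The induction starts at Phi(B_4) = c^3 + 2cd + 2dc; in Phi(B_3) = c^2 + d the coefficient of d
    is too small. *)
Lemma simplex_cd_ge (k : nat) (w : seq cdletter) : (3 <= k)%N -> cddeg w = k ->
  (2 ^ nd w)%:Z <= simplex_cd k w.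
Proof.
elim: k w => [//|k IH] w; rewrite leq_eqVlt => /orP[/eqP <-|k3] dw.
  by case: (cddeg3 w dw) => ->.
case: w dw => [//|l w] dw; have {}IH v := IH v k3.
case: l dw => dw; rewrite [leRHS]/=.
  apply: (le_trans (IH w _)); first by case: dw.
  by rewrite lerDl; apply: dercd_ge0 => v; apply: simplex_cd_ge0.
have dw' : (cddeg w).+1 = k by case: dw.
have Hc := IH (Lc :: w) dw'.
rewrite add0r.
have Hd := dercd_ge0 (fun v => simplex_cd k (Ld :: v)) w (fun v => simplex_cd_ge0 k _).
have -> : nd (Ld :: w) = (nd w).+1 by [].
have Ec : nd (Lc :: w) = nd w by [].
rewrite Ec in Hc; rewrite expnS.
(* A word vd arises from vc, which gives half of the bound. The other half comes from v'd through d
   -> cd if v = v'c, and from v'cd through c -> d if v = v'd. *)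
case: w dw dw' Hc Hd {Ec} => [/=|[] w] dw dw' Hc Hd.
- by move: k3; rewrite -dw'.
- have := IH (Ld :: w) dw'; rewrite -[nd (Ld :: w)]/(nd w).+1 expnS.
  rewrite -[nd (Lc :: w)]/(nd w) in Hc *; move: Hd; lia.
have := IH [:: Ld, Lc & w] dw'.
have := dercd_ge0 (fun v => simplex_cd k [:: Ld, Ld & v]) w (fun v => simplex_cd_ge0 k _).
rewrite -[nd [:: Ld, Lc & w]]/(nd w).+1 /=.
rewrite -[nd (Ld :: w)]/(nd w).+1 in Hc *; move: Hc.
set e := (X in _ + (_ + X) + 0); have : 0 <= e.
  by rewrite /e; case: (w) => [|[] ?] //; apply: simplex_cd_ge0.
rewrite ?add1n; move: (2 ^ _)%N e; lia.
Qed.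

(** For i = 1, the word wd arises from wc, whose coefficient is bounded by [simplex_cd_ge]. Larger i
    follow by induction from k + i = 4, that is n = 5; for n = 4 the bound fails, dd having
    coefficient 1 in checkPhi^4_1. *)
Lemma check_cd_ge (i k : nat) (w : seq cdletter) : (4 <= k + i)%N ->
  (0 < i)%N -> (cddeg w).+1 = (k + i)%N -> (2 ^ nd w)%:Z <= check_cd i k (Ld :: w).
Proof.
elim: i w => [//|i IH] w ki _ dw.
case: (posnP i) => [i0|i_gt0].
  rewrite {IH}i0 addn1 in ki dw *; case: dw => dw.
  rewrite /= -[leLHS]addr0 -addrA lerD ?simplex_cd_ge //.
  rewrite addr_ge0 ?dercd_ge0 //.
  by case: w {dw} => [|[] w].
rewrite addnS in ki dw; case: dw => dw.
have := ki; rewrite leq_eqVlt => /orP[/eqP[ki3]|{}ki].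
  (* The polynomials checkPhi^5_j with j = 2, 3, 4, evaluated on the three words of degree 3. *)
  case: i k i_gt0 ki3 {IH ki} dw => [//|i] k _ ki3 dw.
  have -> : k = (2 - i)%N by lia.
  have {dw}: cddeg w = 3 by lia.
  have {ki3}: (i < 3)%N by lia.
  by case: i => [|[|[|]]] //  _ /cddeg3 [] ->.
have P0 := check_cd_ge0 i k.
have {}IH v : (cddeg v).+1 = (k + i)%N -> (2 ^ nd v)%:Z <= check_cd i k (Ld :: v).
  by apply: IH => //; lia.
rewrite /=; move: (check_cd i k) P0 IH => P P0 IH.
(* The induction bounds [P] only on words with head [Ld]. For a head d followed by c, the single
   term from d -> cd suffices. Followed by another d, one term turns that d back into c, and the
   letter after it provides a second term of the same size. *)
case: w dw => [|[] w] dw; first by move: ki; rewrite -dw.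
  have := IH w dw.
  have := dercd_ge0 (fun v => P (Ld :: v)) (Lc :: w) (fun v => P0 _).
  have := P0 [:: Lc, Lc & w].
  rewrite -[nd (Lc :: w)]/(nd w); lia.
have := IH (Lc :: w) dw; have := P0 [:: Lc, Ld & w].
rewrite -[nd (Lc :: w)]/(nd w) -[nd (Ld :: w)]/(nd w).+1 expnS [dercd _ _]/= addr0.
case: w dw => [|[] w] dw; first by move: ki; rewrite -dw.
  have := IH (Ld :: w) dw.
  have := dercd_ge0 (fun v => P [:: Ld, Ld & v]) (Lc :: w) (fun v => P0 _).
  rewrite -[nd (Lc :: w)]/(nd w) -[nd (Ld :: w)]/(nd w).+1 expnS /= ?add1n; lia.
have := IH [:: Ld, Lc & w] dw.
have := dercd_ge0 (fun v => P [:: Ld, Ld, Ld & v]) w (fun v => P0 _).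
rewrite -[nd [:: Ld, Lc & w]]/(nd w).+1 -[nd (Ld :: w)]/(nd w).+1 [dercd _ (Ld :: w)]/=.
set e := (X in _ + (_ + (_ + X) + 0)); have : 0 <= e by rewrite /e; case: (w) => [|[] ?].
move: (2 ^ _)%N e; lia.
Qed.

(** * From rank sets to ab-words *)

(** Words grow at the end because [h_of_f], acting on reversed words, consumes the last letter
    first. *)
Fixpoint bwords (n : nat) : seq (seq bool) :=
  if n is k.+1 then
    [seq rcons v false | v <- bwords k] ++ [seq rcons v true | v <- bwords k]
  else [:: [::]].

Lemma mem_bwords (n : nat) (v : seq bool) : (v \in bwords n) = (size v == n).
Proof.
elim: n v => [|n IH] v /=; first by rewrite inE; case: v.
rewrite mem_cat; case/lastP: v => [|v x].
  by apply/norP; split; apply/mapP => -[w _]; case: w.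
rewrite size_rcons eqSS -IH; apply/orP/idP => [[]/mapP[w wn /rcons_inj[-> _]]//|vn].
by case: x; [right|left]; apply: map_f.
Qed.

Lemma uniq_bwords (n : nat) : uniq (bwords n).
Proof.
elim: n => //= n IH; rewrite cat_uniq !map_inj_uniq ?IH ?andbT //=;
  try exact: rcons_injl.
by apply/hasPn => _ /mapP[v _ ->]; apply/mapP => -[w _ /rcons_inj[]].
Qed.

Lemma big_sets_bwords (n : nat) (F : {set 'I_n} -> int) :
  \sum_T F T = \sum_(v <- bwords n) F [set i : 'I_n | nth false v i].
Proof.
rewrite -(big_map (fun v : seq bool => [set i : 'I_n | nth false v i]) predT F).
apply: perm_big; apply: uniq_perm; first exact: index_enum_uniq.
  rewrite map_inj_in_uniq ?uniq_bwords // => u v.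
  rewrite !mem_bwords => /eqP su /eqP sv /setP uv.
  apply: (@eq_from_nth _ false) => [|i]; rewrite ?su ?sv // => lin.
  by have := uv (Ordinal lin); rewrite !inE.
move=> T; rewrite mem_index_enum; symmetry; apply/mapP.
exists [seq i \in T | i <- enum 'I_n].
  by rewrite mem_bwords size_map size_enum_ord.
apply/setP => i; rewrite inE (nth_map i) ?size_enum_ord //.
by rewrite nth_ord_enum.
Qed.

(** The sign together with the condition that T lies in S is a product over positions, whose factors
    are the matrix of a -> a - b, b -> b. *)
Lemma sum_bwords_h_of_f (n : nat) (u : seq bool) (G : seq bool -> int) :
  size u = n ->
  \sum_(v <- bwords n)
    (\prod_(i < n) (if nth false u i then if nth false v i then 1 else -1
                    else if nth false v i then 0 else 1)) * G (rev v) =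
  h_of_f G (rev u).
Proof.
elim: n u G => [|n IH] u G.
  by move/size0nil ->; rewrite big_seq1 big_ord0 mul1r.
case/lastP: u => [//|u x]; rewrite size_rcons => -[su].
rewrite big_cat !big_map rev_rcons.
have E y : \sum_(j <- bwords n)
   \prod_(i < n.+1)
      (if nth false (rcons u x) i then if nth false (rcons j y) i then 1 else -1
       else if nth false (rcons j y) i then 0 else 1) * G (rev (rcons j y)) =
   (if x then if y then 1 else -1 else if y then 0 else 1) *
     h_of_f (fun v => G (y :: v)) (rev u).
  rewrite -(IH u) // mulr_sumr big_seq [RHS]big_seq; apply: eq_bigr => v.
  rewrite mem_bwords => /eqP sv.
  rewrite big_ord_recr /= !nth_rcons su sv ltnn eqxx rev_rcons.
  rewrite mulrA [_ * \prod_(i < n) _]mulrC; congr (_ * _ * _).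
  by apply: eq_bigr => i _; rewrite !nth_rcons su sv ltn_ord.
by rewrite !E; case: x {E} => /=; ring.
Qed.

Lemma flag_h_word (E : finType) (P : pred E) (lt : rel E) (rk : E -> nat)
    (u : seq bool) :
  ab_index P lt rk (size u) u =
  h_of_f (fun r => (flag_f P lt rk [set i : 'I_(size u) | nth false (rev r) i])%:Z)
    (rev u).
Proof.
rewrite -(@sum_bwords_h_of_f (size u)) // /ab_index /flag_h big_mkcond big_sets_bwords.
apply: eq_bigr => v _; rewrite revK.
set S := [set i : 'I__ | nth false u i]; set T := [set i : 'I__ | nth false v i].
case: ifPn => [/subsetP ST|/subsetPn[i]]; last first.
  by rewrite !inE => vi /negbTE ui; rewrite (bigD1 i) //= ui vi !mul0r.
congr (_ * _); rewrite -prodr_const big_mkcond; apply: eq_bigr => i _.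
have := ST i; rewrite !inE.
by case: (nth false u i) (nth false v i) => [] [] // /(_ isT).
Qed.

(** * Chains in a ranked relation, by recursion on the top rank *)

Section Chains.
Variables (E : finType) (lt : rel E) (rk : E -> nat).
Implicit Types (P : pred E) (s : nat -> bool).
Hypothesis rk_lt : forall x y, lt x y -> (rk x < rk y)%N.

(** The rank set is a predicate on [nat], so that n can change without casts between ordinal
    types. *)
Definition chains P n s : {set {set E}} :=
  [set C : {set E} |
      [&& [forall x in C, P x && (0 < rk x <= n)%N],
          [forall x in C, forall y in C, [|| x == y, lt x y | lt y x]] &
          [forall i : 'I_n, [exists x in C, rk x == i.+1] == s i]]].

Lemma chainsP P n s (C : {set E}) :
  reflect [/\ forall x, x \in C -> P x && (0 < rk x <= n)%N,
              forall x y, x \in C -> y \in C -> [|| x == y, lt x y | lt y x] &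
              forall i, (i < n)%N -> [exists x in C, rk x == i.+1] = s i]
          (C \in chains P n s).
Proof.
rewrite inE; apply: (iffP and3P) => [[/forall_inP H1 /forall_inP H2 /forallP H3]|[H1 H2 H3]].
  split=> // [x y xC yC|i lin]; first by move/forall_inP: (H2 x xC); apply.
  by have /eqP := H3 (Ordinal lin).
split; first exact/forall_inP.
  by apply/forall_inP => x xC; apply/forall_inP => y yC; apply: H2.
by apply/forallP => i; apply/eqP; apply: H3.
Qed.

Lemma eq_chains P Q n s s' :
  P =1 Q -> (forall i, (i < n)%N -> s i = s' i) -> chains P n s = chains Q n s'.
Proof.
move=> PQ ss; apply/setP => C; apply/chainsP/chainsP => -[H1 H2 H3]; split=> // [x /H1|i lin].
- by rewrite PQ.
- by rewrite H3 ?ss.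
- by rewrite PQ.
- by rewrite H3 ?ss.
Qed.

Lemma flag_f_chains P n s :
  flag_f P lt rk [set i : 'I_n | s i] = #|chains P n s|.
Proof.
rewrite /flag_f /chains; apply: eq_card => C; rewrite !inE; congr (_ && (_ && _)).
apply/eqP/forallP => [/setP eC i|eC].
  by have := eC i; rewrite !inE => ->.
by apply/setP => i; rewrite [LHS]in_set [RHS]in_set; apply/eqP: (eC i).
Qed.

Lemma card_chains0 P s : #|chains P 0 s| = 1%N.
Proof.
rewrite -(cards1 (set0 : {set E})); congr #|pred_of_set _|.
apply/setP => C; rewrite [RHS]in_set1.
apply/chainsP/eqP => [[H1 _ _]|->]; last by split=> // x; rewrite inE.
apply/setP => x; rewrite inE; apply/negP => /H1; lia.
Qed.

Lemma chains_skip P n s : ~~ s n -> chains P n.+1 s = chains P n s.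
Proof.
move=> /negbTE sn; apply/setP => C; apply/chainsP/chainsP => -[H1 H2 H3]; split=> //.
- move=> x xC; have /andP[Px /andP[r0 rn]] := H1 x xC; rewrite Px r0 /=.
  move: rn; rewrite leq_eqVlt ltnS => /orP[rn|//].
  by have := H3 n (leqnn _); rewrite sn => /negbT/negP[]; apply/existsP; exists x; rewrite xC.
- by move=> i lin; apply: H3; apply: ltnW.
- by move=> x xC; have /andP[-> /andP[-> /leqW]] := H1 x xC.
move=> i; rewrite ltnS leq_eqVlt => /orP[/eqP ->|]; last exact: H3.
rewrite sn; apply/negbTE/negP => /existsP[x /andP[xC /eqP rx]].
by have := H1 x xC; rewrite rx ltnn !andbF.
Qed.

Lemma card_chains_top P n s : s n ->
  #|chains P n.+1 s| =
  (\sum_(x | P x && (rk x == n.+1)) #|chains (fun y => P y && lt y x) n s|)%N.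
Proof.
move=> sn.
(* Double counting: each chain contains exactly one element of rank n + 1, since related elements
   have different ranks. Removing it leaves a chain below it. *)
transitivity (\sum_(C in chains P n.+1 s)
    \sum_(x | P x && (rk x == n.+1)) (x \in C))%N.
  rewrite -sum1_card; apply: eq_bigr => C /chainsP[H1 H2 H3].
  have := H3 n (leqnn _); rewrite sn => /existsP[x /andP[xC rx]].
  have /andP[Px _] := H1 x xC.
  rewrite (bigD1 x) /= ?Px ?rx // xC big1 // => y /andP[/andP[Py ry] yx].
  apply/eqP; rewrite eqb0; apply/negP => yC.
  have := H2 x y xC yC; rewrite eq_sym (negbTE yx) /= => /orP[] /rk_lt.
    by rewrite (eqP rx) (eqP ry) ltnn.
  by rewrite (eqP rx) (eqP ry) ltnn.
rewrite exchange_big; apply: eq_bigr => x /andP[Px /eqP rx].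
have xnot C : C \in chains (fun y => P y && lt y x) n s -> x \notin C.
  by move=> /chainsP[H1 _ _]; apply/negP => /H1; rewrite rx ltnn !andbF.
rewrite -(card_in_imset (f := fun C => x |: C)) => [|C D /xnot xC /xnot xD eCD]; last first.
  by rewrite -(setU1K xC) eCD setU1K.
rewrite -big_mkcondr /= sum1_card -[RHS]sum1_card -[LHS]sum1_card.
apply: eq_bigl => C; apply/andP/imsetP => [[/chainsP[H1 H2 H3] xC]|[D DC ->]].
  exists (C :\ x); last by rewrite setD1K.
  have rkC y : y \in C :\ x -> lt y x && (rk y <= n)%N.
    rewrite in_setD1 => /andP[yx yC]; have := H2 y x yC xC.
    have /andP[_ /andP[_ ry]] := H1 y yC.
    rewrite (negbTE yx) /= => /orP[/[dup] /rk_lt|/rk_lt]; rewrite rx ?ltnS => r.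
      by move=> ->.
    by move: ry; rewrite leqNgt r.
  apply/chainsP; split.
  - move=> y yC; have /andP[-> ->] := rkC y yC.
    by move: yC; rewrite in_setD1 => /andP[_ /H1 /andP[-> /andP[->]]].
  - by move=> y z; rewrite !in_setD1 => /andP[_ yC] /andP[_ zC]; apply: H2.
  move=> i lin; rewrite -H3 ?leqW //; apply/existsP/existsP => -[y /andP[yC ry]]; exists y.
    by move: yC; rewrite in_setD1 => /andP[_ ->].
  rewrite in_setD1 yC ry !andbT; apply/eqP => yx.
  by move: ry lin; rewrite yx rx eqSS => /eqP ->; rewrite ltnn.
have xD := xnot D DC; move/chainsP: DC => [H1 H2 H3].
split; last by rewrite setU11.
apply/chainsP; split.
- move=> y /setU1P[->|/H1 /andP[/andP[-> _] /andP[-> /leqW]]] //.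
  by rewrite Px rx leqnn.
- move=> y z /setU1P[->|yD] /setU1P[->|zD]; rewrite ?eqxx //.
  + by have /andP[/andP[_ ->] _] := H1 z zD; rewrite !orbT.
  + by have /andP[/andP[_ ->] _] := H1 y yD; rewrite !orbT.
  exact: H2.
move=> i; rewrite ltnS leq_eqVlt => /orP[/eqP ->|lin].
  by rewrite sn; apply/existsP; exists x; rewrite setU11 rx eqxx.
rewrite -H3 //; apply/existsP/existsP => -[y /andP[yC ry]]; exists y.
  move: yC ry => /setU1P[->|-> ->//]; rewrite rx eqSS => /eqP ni.
  by rewrite ni ltnn in lin.
by rewrite setU1r.
Qed.

Definition nchains P (r : seq bool) : nat := #|chains P (size r) (nth false (rev r))|.

Lemma nchains0 P : nchains P [::] = 1%N.
Proof. exact: card_chains0. Qed.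

Lemma nchains_cons P (x : bool) (r : seq bool) :
  nchains P (x :: r) =
  if x then (\sum_(y | P y && (rk y == (size r).+1))
               nchains (fun z => P z && lt z y) r)%N
  else nchains P r.
Proof.
have top : nth false (rev (x :: r)) (size r) = x.
  by rewrite rev_cons nth_rcons size_rev ltnn eqxx.
have low Q : chains Q (size r) (nth false (rev (x :: r))) =
    chains Q (size r) (nth false (rev r)).
  by apply: eq_chains => // i lin; rewrite rev_cons nth_rcons size_rev lin.
case: x top low => top low; rewrite /nchains /=.
  by rewrite card_chains_top ?top //; apply: eq_bigr => y _; rewrite low.
by rewrite chains_skip ?top // low.
Qed.

Lemma ab_index_nchains P (u : seq bool) :
  ab_index P lt rk (size u) u = h_of_f (fun r => (nchains P r)%:Z) (rev u).
Proof.
rewrite flag_h_word; apply: eq_h_of_f => r; rewrite size_rev => sr.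
by rewrite flag_f_chains /nchains sr.
Qed.

End Chains.
Arguments nchains {E} lt rk P r.

(** * Counting simplices through the vertices they miss *)

Section Counting.
Variable T : finType.
Implicit Types A X : {set T}.

Lemma card_cosub A t : (t <= #|T|)%N ->
  #|[set X : {set T} | ~: X \subset A & #|X| == t]| = 'C(#|A|, #|T| - t).
Proof.
move=> tT; rewrite -cards_draws -(card_imset _ (@setC_inj T)).
apply: eq_card => X; apply/imsetP/idP => [[Y]|].
  rewrite !inE => /andP[YA /eqP <-] ->; rewrite YA /=.
  by rewrite -(cardsC Y) addKn.
rewrite inE => /andP[XA /eqP Xt]; exists (~: X); last by rewrite setCK.
rewrite inE setCK XA /= -(eqn_add2l #|X|) cardsC Xt subnK //.
Qed.

Lemma card_not_cosub A t : (t <= #|T|)%N ->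
  (#|[set X : {set T} | ~~ (~: X \subset A) & #|X| == t]| + 'C(#|A|, #|T| - t) =
   'C(#|T|, t))%N.
Proof.
move=> tT; rewrite -card_draws -card_cosub // addnC.
rewrite -(cardsID [set X : {set T} | ~: X \subset A] [set X : {set T} | #|X| == t]).
by congr (_ + _)%N; apply: eq_card => X; rewrite !inE // andbC.
Qed.

(** The two excluded families are disjoint: a set in both would have empty complement, against t <
    #|T|. *)
Lemma card_not_cosub2 A t : (t < #|T|)%N ->
  (#|[set X : {set T} | ~~ (~: X \subset A) && ~~ (~: X \subset ~: A) & #|X| == t]| +
   'C(#|A|, #|T| - t) + 'C(#|~: A|, #|T| - t) = 'C(#|T|, t))%N.
Proof.
move=> tT; rewrite -(card_not_cosub (~: A)) ?(ltnW tT) //; congr (_ + _)%N.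
rewrite -card_cosub ?(ltnW tT) // addnC.
rewrite -(cardsID [set X : {set T} | ~: X \subset A]
            [set X : {set T} | ~~ (~: X \subset ~: A) & #|X| == t]).
congr (_ + _)%N; apply: eq_card => X; rewrite !inE; last first.
  by rewrite andbA.
case: (boolP (~: X \subset A)) => XA; rewrite ?andbF //= andbT.
case: eqP => Xt; rewrite ?andbF // andbT; apply/esym/negP => XA'.
have : ~: X \subset A :&: ~: A by rewrite subsetI XA.
rewrite setICr subset0 => /eqP X0; have := cardsC X; rewrite X0 cards0 addn0 Xt => tE;
  by rewrite tE ltnn in tT.
Qed.

End Counting.

Lemma card_ord_le (n i : nat) : (i <= n)%N -> #|[set k : 'I_n.+1 | (k <= i)%N]| = i.+1.
Proof.
move=> lin; rewrite -sum1_card; under eq_bigl do rewrite inE -ltnS.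
by rewrite -(big_ord_widen n.+1 (fun=> 1%N)) // sum1_card card_ord.
Qed.

Lemma card_ord_gt (n i : nat) : (i <= n)%N ->
  #|[set k : 'I_n.+1 | (i < k)%N]| = (n - i)%N.
Proof.
move=> lin; have := cardsC [set k : 'I_n.+1 | (k <= i)%N].
rewrite card_ord_le // card_ord.
have -> : ~: [set k : 'I_n.+1 | (k <= i)%N] = [set k : 'I_n.+1 | (i < k)%N].
  by apply/setP => k; rewrite !inE ltnNge.
lia.
Qed.

(** * Cells of Lambda^n_i and their numbers by dimension *)

Lemma cell_lt_rank (n i : nat) (x y : cell n) :
  cell_lt i x y -> (cell_rank x < cell_rank y)%N.
Proof.
case: x y => [X|] [Y|] /andP[xy /= le] //=.
  by apply: proper_card; rewrite properEneq le andbT; apply: contra xy => /eqP ->.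
case/existsP: le => a /existsP[b /and4P[ai ib aX bX]].
have ab : a != b by apply: contraTneq ai => ->; rewrite -ltnNge.
(* A face of tau misses two distinct vertices, hence has fewer than n vertices. *)
have : (#|X| + #|[set a; b]| <= n.+1)%N.
  rewrite -[leqRHS](card_ord n.+1) -(cardsC X) leq_add2l; apply: subset_leq_card.
  by apply/subsetP => c /set2P[] ->; rewrite inE.
by rewrite cards2 ab addn2 ltnS.
Qed.

Lemma card_cells (n : nat) (Q : pred (cell n)) :
  ~~ Q None -> #|[pred y | Q y]| = #|[set X | Q (Some X)]|.
Proof.
move=> Q0; rewrite -(card_imset _ (@Some_inj _)); apply: eq_card => y; rewrite inE.
apply/idP/imsetP => [|[X]]; last by rewrite inE => QX ->.
by case: y => [X|] Qy; [exists X; rewrite ?inE | rewrite Qy in Q0].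
Qed.

Definition levels {n : nat} (p : pred {set 'I_n.+1}) (t : nat) : int :=
  #|[set X | p X & #|X| == t]|.

(** Ranks stay below n, so tau never occurs, and below a simplex the poset is Boolean because p is
    closed under subsets. The empty set satisfies p so that level 0 counts the empty chain once. *)
Lemma nchains_simplices (n i : nat) (P : pred (cell n)) (p : pred {set 'I_n.+1})
    (r : seq bool) :
  (size r < n)%N -> p set0 ->
  (forall X Y : {set 'I_n.+1}, Y \subset X -> p X -> p Y) ->
  (forall X : {set 'I_n.+1}, X != set0 -> (#|X| <= size r)%N -> P (Some X) = p X) ->
  (nchains (cell_lt i) (@cell_rank n) P r)%:Z = topsum (levels p) r.
Proof.
elim: r P p => [|x r IH] P p rn p0 pS Pp.
  rewrite nchains0 /= /levels (_ : [set X | _ & _] = [set set0]) ?cards1 //.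
  apply/setP => X; rewrite !inE cards_eq0 andbC.
  by case: eqP => // ->.
rewrite nchains_cons; last exact: cell_lt_rank.
case: x rn Pp => rn Pp; last first.
  by apply: IH => // [|X X0 Xr]; [apply: ltnW | apply: Pp => //; apply: leqW].
have inner y : P y && (cell_rank y == (size r).+1) ->
    (nchains (cell_lt i) (@cell_rank n) (fun z => P z && cell_lt i z y) r)%:Z =
    topsum (fun t => ('C((size r).+1, t))%:Z) r.
  case: y => [X|] /andP[Py /eqP /= ry]; last by rewrite /= -ry ltnn in rn.
  have X0 : X != set0 by rewrite -card_gt0 ry.
  have pX : p X by rewrite -Pp ?ry.
  rewrite (IH _ (fun Y => Y \subset X)) //=; first 1 last.
  - exact: ltnW.
  - exact: sub0set.
  - by move=> Y Z /subset_trans ZY; apply: ZY.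
  - move=> Y Y0 Yr; rewrite Pp ?leqW // /cell_lt /=.
    case YX: (Y \subset X); last by rewrite !andbF.
    rewrite (pS X Y) // andbT; apply/eqP => -[YX']; rewrite YX' ry in Yr.
    by rewrite ltnn in Yr.
  by apply: eq_topsum => t _; rewrite /levels cards_draws ry.
rewrite -natz natr_sum.
rewrite (eq_bigr (fun=> topsum (fun t => ('C((size r).+1, t))%:Z) r)); last first.
  by move=> y Qy; rewrite natz inner.
rewrite sumr_const card_cells; last by rewrite /= (gtn_eqF rn) andbF.
rewrite -mulr_natl natz /levels; congr (Posz _ * _).
apply: eq_card => X; rewrite !inE.
case: eqP => /= rX; rewrite ?andbF // !andbT.
by apply: Pp; rewrite -?card_gt0 rX.
Qed.

(** The faces of Gamma^n_i, with the empty face. *)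
Definition misses_low (n i : nat) (X : {set 'I_n.+1}) : bool :=
  [exists k : 'I_n.+1, (k <= i)%N && (k \notin X)].

(** The faces of the boundary of Gamma^n_i, with the empty face. *)
Definition misses_both (n i : nat) (X : {set 'I_n.+1}) : bool :=
  [exists a : 'I_n.+1, exists b : 'I_n.+1,
     [&& (a <= i)%N, (i < b)%N, a \notin X & b \notin X]].

Lemma misses_lowE (n i : nat) (X : {set 'I_n.+1}) :
  misses_low n i X = ~~ (~: X \subset [set k : 'I_n.+1 | (i < k)%N]).
Proof.
apply/existsP/subsetPn => [[k /andP[ki kX]]|[k]].
  by exists k; rewrite inE // -leqNgt.
by rewrite !inE -leqNgt => kX ki; exists k; rewrite ki.
Qed.

Lemma misses_bothE (n i : nat) (X : {set 'I_n.+1}) :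
  misses_both n i X = ~~ (~: X \subset [set k : 'I_n.+1 | (i < k)%N]) &&
    ~~ (~: X \subset ~: [set k : 'I_n.+1 | (i < k)%N]).
Proof.
rewrite -misses_lowE.
apply/existsP/andP => [[a /existsP[b /and4P[ai ib aX bX]]]|[/existsP[a /andP[ai aX]]]].
  split; first by apply/existsP; exists a; rewrite ai.
  by apply/subsetPn; exists b; rewrite !inE // ib.
case/subsetPn => b; rewrite !inE negbK => bX ib.
by exists a; apply/existsP; exists b; rewrite ai ib aX.
Qed.

Lemma levels_low (n i t : nat) : (i <= n)%N -> (t <= n.+1)%N ->
  levels (misses_low n i) t = ('C(n.+1, t))%:Z - ('C(n - i, n.+1 - t))%:Z.
Proof.
move=> lin tn; rewrite -(card_ord_gt _ _ lin).
have := card_not_cosub _ [set k : 'I_n.+1 | (i < k)%N] t; rewrite card_ord => /(_ tn) <-.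
rewrite PoszD addrK /levels; congr Posz; congr #|pred_of_set _|.
by apply/setP => X; rewrite !inE misses_lowE.
Qed.

Lemma levels_both (n i t : nat) : (i <= n)%N -> (t <= n)%N ->
  levels (misses_both n i) t =
  ('C(n.+1, t))%:Z - ('C(n - i, n.+1 - t))%:Z - ('C(i.+1, n.+1 - t))%:Z.
Proof.
move=> lin tn; rewrite -(card_ord_gt _ _ lin) -[in X in _ - X](card_ord_le _ _ lin).
have -> : [set k : 'I_n.+1 | (k <= i)%N] = ~: [set k : 'I_n.+1 | (i < k)%N].
  by apply/setP => k; rewrite !inE -leqNgt.
have := card_not_cosub2 _ [set k : 'I_n.+1 | (i < k)%N] t; rewrite card_ord => /(_ tn) <-.
rewrite !PoszD addrAC addrK addrK /levels; congr Posz; congr #|pred_of_set _|.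
by apply/setP => X; rewrite !inE misses_bothE.
Qed.

(** * Flag enumerators of Lambda^n_i and their differences *)

Definition Lambda_f (n i : nat) (r : seq bool) : int :=
  nchains (cell_lt i) (@cell_rank n) (@is_cell n i) r.

Lemma Lambda_abE (n i : nat) (u : seq bool) :
  size u = n -> Lambda_ab n i u = h_of_f (Lambda_f n i) (rev u).
Proof. by move=> <-; apply: ab_index_nchains; apply: cell_lt_rank. Qed.

Lemma Lambda_f_false (n i : nat) (r : seq bool) : (size r < n)%N ->
  Lambda_f n i (false :: r) = topsum (levels (misses_low n i)) r.
Proof.
move=> rn; rewrite /Lambda_f nchains_cons; last exact: cell_lt_rank.
apply: nchains_simplices => // [|X Y YX|X X0 _]; last by rewrite /= X0.
  by apply/existsP; exists ord0; rewrite inE.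
by move=> /existsP[k /andP[ki kX]]; apply/existsP; exists k; rewrite ki (contra _ kX) //;
  apply: (subsetP YX).
Qed.

Lemma Lambda_f_true (n i : nat) (r : seq bool) : (i < n)%N -> (size r).+1 = n ->
  Lambda_f n i (true :: r) =
  levels (misses_low n i) n * topsum (fun t => ('C(n, t))%:Z) r +
  topsum (levels (misses_both n i)) r.
Proof.
move=> lin rn; rewrite /Lambda_f nchains_cons; last exact: cell_lt_rank.
(* The top cell is either tau, with the boundary of Gamma^n_i below it, or a facet of Gamma^n_i,
   with a Boolean lattice below it. *)
rewrite (bigD1 None) /= ?rn ?eqxx // PoszD addrC; congr (_ + _); last first.
  apply: nchains_simplices; rewrite ?rn //.
  - apply/existsP; exists ord0; apply/existsP; exists ord_max.
    by rewrite !inE lin.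
  - move=> X Y YX /existsP[a /existsP[b /and4P[ai ib aX bX]]].
    apply/existsP; exists a; apply/existsP; exists b; rewrite ai ib.
    by rewrite (contra _ aX) ?(contra _ bX) //; apply: (subsetP YX).
  move=> X X0 _; rewrite /= X0 /=; apply/andP/idP => [[_ /andP[]]//|XN].
  split; last by rewrite /cell_lt.
  case/existsP: XN => a /existsP[b /and4P[ai ib aX bX]].
  by apply/existsP; exists a; rewrite ai.
rewrite -natz natr_sum (eq_bigr (fun=> topsum (fun t => ('C(n, t))%:Z) r)); last first.
  case=> [X|] /andP[/andP[PX rX] // _]; rewrite natz.
  rewrite (@nchains_simplices n i _ (fun Y => Y \subset X)) ?rn //.
  - apply: eq_topsum => t _; rewrite /levels cards_draws.
    by move: rX => /= /eqP ->.
  - exact: sub0set.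
  - by move=> Y Z /subset_trans ZY; apply: ZY.
  move=> Y Y0 Yr; rewrite /cell_lt /= Y0 /=.
  have YX : Some Y != Some X.
    apply/eqP => -[YX]; move: rX; rewrite /= -YX => /eqP YN.
    by rewrite YN -rn ltnn in Yr.
  rewrite YX /=; apply/andP/idP => [[]//|sYX]; split=> //.
  move: PX => /= /andP[_ /existsP[k /andP[ki kX]]]; apply/existsP; exists k.
  by rewrite ki (contra _ kX) //; apply: (subsetP sYX).
rewrite sumr_const card_cells /= ?eqxx ?andbF //.
rewrite -mulr_natl natz /levels; congr (Posz _ * _).
apply: eq_card => X; rewrite !inE andbT.
case: (#|X| =P n) => rX; last by rewrite !andbF.
by rewrite -card_gt0 rX (leq_trans _ lin).
Qed.

Lemma Lambda_f0 (n : nat) (r : seq bool) : size r = n.+1 ->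
  Lambda_f n.+1 0 r = check_f n.+1 0 r.
Proof.
case: r => // x r [rn].
have low t : (t <= n.+1)%N ->
    levels (misses_low n.+1 0) t = ('C(n.+1, n.+1 - t))%:Z.
  move=> tn; have tn2 := leqW tn.
  rewrite levels_low // -(bin_sub tn2) subn0.
  by rewrite (subSn tn) binS; lia.
case: x; last first.
  rewrite Lambda_f_false ?rn //= subn0; apply: eq_topsum => t tr.
  by apply: low; rewrite rn in tr; apply: leqW.
rewrite Lambda_f_true ?rn // low // subnn bin0 mul1r /= -topsumD.
apply: eq_topsum => t; rewrite rn => tn.
have tn1 := leqW tn; have tn2 := leqW tn1.
rewrite levels_both // subn0 -(bin_sub tn2).
rewrite (subSn tn1) (binS n.+1) (@bin_small 0) ?subn_gt0 // (@bin_small 1) ?ltnS ?subn_gt0 //.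
lia.
Qed.

(** The simplices added with sigma_{i+1} contain 0, ..., i and miss i + 1. At the top rank this is
    one more facet, giving ['C(n.+1, t)]; the change in the boundary of tau gives the other two
    binomials of [check_f]. *)
Lemma Lambda_f_diff (n i : nat) (r : seq bool) : (i < n)%N -> size r = n.+1 ->
  Lambda_f n.+1 i.+1 r - Lambda_f n.+1 i r = check_f n.+1 i.+1 r.
Proof.
move=> lin; case: r => // x r [rn].
have low t : (t <= n.+1)%N ->
    levels (misses_low n.+1 i.+1) t - levels (misses_low n.+1 i) t =
    ('C(n.+1 - i.+1, n.+1 - t))%:Z.
  move=> tn; have tn2 := leqW tn; have lin1 := leqW (ltnW lin); have lin2 := ltnW lin.
  rewrite !levels_low // subSS (subSn tn) (subSn (ltnW lin)) binS; lia.
case: x; last first.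
  rewrite !Lambda_f_false ?rn //= -topsumB; apply: eq_topsum => t tr.
  by apply: low; rewrite rn in tr; apply: leqW.
have low_top := low n.+1 (leqnn _); rewrite subnn bin0 in low_top.
rewrite !Lambda_f_true ?rn ?ltnS ?(ltnW lin) //.
set U := topsum (fun t => ('C(n.+1, t))%:Z) r.
transitivity (U + (topsum (levels (misses_both n.+1 i.+1)) r -
                   topsum (levels (misses_both n.+1 i)) r)).
  rewrite (canRL (subrK _) low_top) -[Posz 1]/(1 : int); ring.
rewrite -topsumB -topsumD; apply: eq_topsum => t; rewrite rn => tn.
have tn1 := leqW tn; have lin1 := leqW (ltnW lin); have lin2 := ltnW lin.
rewrite !levels_both // subSS (subSn tn1) (subSn (ltnW lin)) (binS i.+1) (binS (n - i)).
lia.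
Qed.

(** * Transfer to the given cd-indices, and the two bounds *)

Lemma ev_cd_index (n j : nat) (Phi : seq cdletter -> int) (r : seq bool) :
  is_cd_index n Phi (Lambda_ab n j) -> size r = n ->
  ev (fun w => Phi (rev w)) r = h_of_f (Lambda_f n j) r.
Proof.
move=> [_ Phi_ab] rn; have urn : size (rev r) = n by rewrite size_rev.
rewrite -[in LHS](revK r) ev_rev -sum_cdwords_ev urn Phi_ab // Lambda_abE //.
by rewrite revK.
Qed.

(* Phi i is the cd-index Phi_{Lambda^n_i}; checkPhi^n_0 = Phi 0 and
   checkPhi^n_j = Phi j - Phi (j-1) for 1 <= j <= n-1. *)
Theorem theorem4p1 (n : nat) (Phi : nat -> seq cdletter -> int) :
  (4 <= n)%N ->
  (forall i, (i < n)%N -> is_cd_index n (Phi i) (Lambda_ab n i)) ->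
  (forall w : seq cdletter, cddeg w = n.-1 ->
     (2 ^ nd w)%:Z <= Phi 0%N (rcons w Lc)) /\
  ((5 <= n)%N -> forall j : nat, (1 <= j <= n.-1)%N ->
     forall w : seq cdletter, cddeg w = (n - 2)%N ->
     (2 ^ nd w)%:Z <= Phi j (rcons w Ld) - Phi j.-1 (rcons w Ld)).
Proof.
case: n => // n n4 cdPhi.
have nd_rev w : nd (rev w) = nd w by apply: count_rev.
have cddeg_rev w : cddeg (rev w) = cddeg w.
  by rewrite /cddeg map_rev sumn_rev.
split=> [w dw|n5 j /andP[j_gt0 jn] w dw].
  (* Both polynomials expand to the same ab-index, so they agree by uniqueness; reversal makes the
     final c the head letter. *)
  have -> : Phi 0%N (rcons w Lc) = check_cd 0 n (Lc :: rev w).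
    apply/eqP; rewrite -subr_eq0; apply/eqP.
    rewrite -[rcons w Lc](revK) rev_rcons.
    apply: (ev_eq0 (fun v => Phi 0%N (rev v) - check_cd 0 n v)) => u su.
    have {}su : size u = n.+1 by rewrite su -[cddeg _]/(cddeg (rev w)).+1 cddeg_rev dw.
    rewrite evB (ev_cd_index n.+1 0) ?su //; last exact: cdPhi.
    rewrite ev_check_cd ?addn0 //; apply/eqP; rewrite subr_eq0; apply/eqP.
    by apply: eq_h_of_f => v; rewrite su; apply: Lambda_f0.
  by rewrite -nd_rev; apply: simplex_cd_ge; rewrite ?cddeg_rev.
case: j j_gt0 jn => // j _ jn; rewrite /= in jn dw *.
(* With i = j + 1 and k = n - (j + 1), [check_cd i k] is checkPhi^{n+1}_{j+1}, as k + i + 1 = n +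
   1. *)
have kj : (n - j.+1 + j.+1)%N = n by rewrite subnK.
have -> : Phi j.+1 (rcons w Ld) - Phi j (rcons w Ld) =
    check_cd j.+1 (n - j.+1) (Ld :: rev w).
  apply/eqP; rewrite -subr_eq0; apply/eqP.
  rewrite -[rcons w Ld](revK) rev_rcons.
  apply: (ev_eq0 (fun v => Phi j.+1 (rev v) - Phi j (rev v) - check_cd j.+1 (n - j.+1) v)).
  move=> u su; have {}su : size u = n.+1.
    by rewrite su -[cddeg _]/(cddeg (rev w)).+2 cddeg_rev dw; lia.
  rewrite !evB (ev_cd_index n.+1 j.+1) ?(ev_cd_index n.+1 j) ?su //; try (apply: cdPhi; lia).
  rewrite ev_check_cd ?kj // -h_of_fB; apply/eqP; rewrite subr_eq0; apply/eqP.
  by apply: eq_h_of_f => v; rewrite su; apply: Lambda_f_diff.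
rewrite -nd_rev; apply: check_cd_ge => //; rewrite ?cddeg_rev kj //; lia.
Qed.
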